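(* Let $(X,\mathcal{H})$ be a hypothesis class and $0<\epsilon<1/2$. Suppose that the $\epsilon$-saturation $\mathcal{H}_\infty(\epsilon)$ is a Littlestone class (hence $\mathcal{H}$ is also a Littlestone class). Then every $\epsilon$-type of $\mathcal{H}_\infty(\epsilon)$ is realized in $\mathcal{H}_\infty(\epsilon)$ (i.e. belongs to $\mathcal{H}_\infty(\epsilon)$); that is, $\mathcal{H}_\infty(\epsilon)$ is $\epsilon$-saturated.
   Context: A hypothesis class $(X,\mathcal{H})$ is a set $X$ (finite or infinite) together with a set $\mathcal{H}$ of functions $h:X\to\{0,1\}$. For $0<\epsilon<1/2$, an $\epsilon$-hypothesis of $\mathcal{H}$ is a finite set of pairs $H=\{(h_i,\gamma_i):i<k\}$ with $h_i\in\mathcal{H}$ pairwise distinct, $\gamma_i\in(0,1]$ real, $\sum_i\gamma_i=1$, such that for every $x\in X$ there is a value $\mathbf{t}_H(x)\in\{0,1\}$ with $\sum\{\gamma_i:h_i(x)=1-\mathbf{t}_H(x)\}<\epsilon$. This defines $\mathbf{t}_H:X\to\{0,1\}$. $\epsilon$-saturation: $\mathcal{H}_0(\epsilon)=\mathcal{H}$; $\mathcal{H}_{n+1}(\epsilon)=\mathcal{H}_n(\epsilon)\cup\{\mathbf{t}_H: H\text{ is an }\epsilon\text{-hypothesis of }\mathcal{H}_n(\epsilon)\}$ (as a set of functions on $X$); $\mathcal{H}_\infty(\epsilon)=\bigcup_{n<\omega}\mathcal{H}_n(\epsilon)$. An $\epsilon$-type of a hypothesis class $(X,\mathbf{H})$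 is a function $f:X\to\{0,1\}$ such that for every finite $Y\subseteq X$ there is an $\epsilon$-hypothesis $H$ of $\mathbf{H}$ with $\mathbf{t}_H\restriction Y=f\restriction Y$. The function $f$ is realized in $\mathbf{H}$ if $f\in\mathbf{H}$. The class $\mathbf{H}$ is $\epsilon$-saturated if every $\epsilon$-type of $\mathbf{H}$ is realized in $\mathbf{H}$. A class is Littlestone if its Littlestone dimension is finite, i.e. there is a finite bound on the heights $d$ of full binary trees with internal nodes labelled by elements of $X$ all of whose branches $\langle(x_i,y_i):1\le i\le d\rangle$ ($x_i$ the $i$-th node label, $y_i=1$ for going right and $0$ for left) are realized by some $h$ in the class, meaning $h(x_i)=y_i$ for all $i$. *)

(* Defs.v *)
From mathcomp Require Import all_boot all_order all_algebra.
From mathcomp Require Import all_classical all_reals.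

Set Implicit Arguments.
Unset Strict Implicit.
Unset Printing Implicit Defensive.

Import Order.TTheory GRing.Theory Num.Theory.

Local Open Scope classical_set_scope.
Local Open Scope ring_scope.

(* A hypothesis class on X is a term HH : set (X -> bool), the labels 0 and 1
   being false and true. *)

Section EpsilonHypotheses.
Variables (R : realType) (X : Type).
Implicit Types (eps : R) (HH : set (X -> bool)) (f : X -> bool).

Record weighted_family := WeightedFamily {
  wf_size : nat;
  wf_hyp : 'I_wf_size -> X -> bool;
  wf_weight : 'I_wf_size -> R }.

Implicit Type H : weighted_family.

Definition weight_against H (x : X) (t : bool) : R :=
  \sum_(i < wf_size H | wf_hyp i x == ~~ t) wf_weight i.

Definition eps_hypothesis eps HH H : Prop :=
  [/\ forall i : 'I_(wf_size H), HH (wf_hyp i),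
      injective (@wf_hyp H),
      forall i : 'I_(wf_size H), 0 < wf_weight i <= 1,
      \sum_(i < wf_size H) wf_weight i = 1
    & forall x, exists t : bool, weight_against H x t < eps].

(* For an eps-hypothesis with eps < 1/2 there is exactly one such t at each x;
   the default value false only matters outside this situation. *)
Definition eps_majority eps H : X -> bool :=
  fun x => xget false [set t : bool | weight_against H x t < eps].

Fixpoint eps_saturation_step eps HH (n : nat) : set (X -> bool) :=
  if n is m.+1 then
    eps_saturation_step eps HH m `|`
    [set eps_majority eps H
      | H in [set H | eps_hypothesis eps (eps_saturation_step eps HH m) H]]
  else HH.

Definition eps_saturation eps HH : set (X -> bool) :=
  \bigcup_n eps_saturation_step eps HH n.

Definition eps_type eps HH f : Prop :=
  forall Y : set X, finite_set Y ->
    exists2 H, eps_hypothesis eps HH H &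
      forall x, Y x -> eps_majority eps H x = f x.

Definition eps_saturated eps HH : Prop :=
  forall f, eps_type eps HH f -> HH f.

End EpsilonHypotheses.

Section Littlestone.
Variable X : Type.
Implicit Type HH : set (X -> bool).

Inductive full_tree : nat -> Type :=
| Leaf : full_tree 0
| Node d : X -> full_tree d -> full_tree d -> full_tree d.+1.

Fixpoint branches d (T : full_tree d) : set (seq (X * bool)) :=
  match T with
  | Leaf => [set [::]]
  | Node _ x l r => [set (x, false) :: b | b in branches l] `|`
                    [set (x, true) :: b | b in branches r]
  end.

Definition realizes (h : X -> bool) (b : seq (X * bool)) : bool :=
  all (fun p => h p.1 == p.2) b.

Definition shattered HH d (T : full_tree d) : Prop :=
  forall b, branches T b -> exists2 h, HH h & realizes h b.

(* The empty class shatters no tree at all, not even a leaf, and counts as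
   Littlestone. *)
Definition Littlestone HH : Prop :=
  exists N : nat, forall d (T : full_tree d), shattered HH T -> (d <= N)%N.

Lemma Littlestone_subset HH HH' : HH `<=` HH' -> Littlestone HH' -> Littlestone HH.
Proof.
move=> sub [N boundN]; exists N => d T shT; apply: (boundN d T) => b /shT.
by case=> h /sub; exists h.
Qed.

End Littlestone.

Lemma Littlestone_eps_saturation (R : realType) (X : Type) (eps : R)
    (HH : set (X -> bool)) :
  Littlestone (eps_saturation eps HH) -> Littlestone HH.
Proof. by apply: Littlestone_subset => h HHh; exists 0%N. Qed.

(* Main.v *)
Require Import Defs.
From mathcomp Require Import all_boot all_order all_algebra.
From mathcomp Require Import all_classical all_reals.
From mathcomp Require Import lra.

Set Implicit Arguments.
Unset Strict Implicit.
Unset Printing Implicit Defensive.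

Import Order.TTheory GRing.Theory Num.Theory.

Local Open Scope classical_set_scope.
Local Open Scope ring_scope.

(** Write G for the saturation.  Each [eps]-hypothesis of G is finite, hence
    lives in one stage, so its majority is again in G
    ([eps_saturation_majority]).  Consequently an [eps]-type f is just a
    pointwise limit of elements of G, and the task is to write such an f as the
    majority of a single [eps]-hypothesis of G.

    The equal-weight average of a long Morley-type sequence does this.  By
    [exists_generic_sequence] there are g 0, g 1, ... in G, each agreeing with f
    on a finite set of points that represents every pattern of values of f and
    of the earlier functions.  If some x had k indices i_0 < ... < i_(k-1) at
    which g disagrees with f, then representing the pattern of x at the
    successive levels i_j + 1 would give points y_j at which g i_l errs
    exactly when l <= j: a half-graph of length k.  Binary search on a half-graph
    of length 2 ^ d shatters a tree of height d ([half_graph_shattered]), so the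
    Littlestone bound N forces k < 2 ^ (N + 1), uniformly in x and in the length
    of the sequence ([generic_sequence_count]).  Taking n functions with
    2 ^ (N + 1) / n < eps, the weight against f is below eps at every point.

    The members of a hypothesis must be distinct, and this is automatic:
    if f is not in G, each g i errs somewhere, and a representative of that
    point's pattern separates g i from all later functions
    ([generic_sequence_inj]). *)

(** * Majorities and the saturation *)

Lemma weight_againstC (R : realType) (X : Type) (H : weighted_family R X) x t :
  weight_against H x t + weight_against H x (~~ t) =
  \sum_(i < wf_size H) wf_weight i.
Proof.
rewrite [RHS](bigID (fun i => wf_hyp i x == ~~ t)) /=; congr (_ + _).
by apply: eq_bigl => i; case: (wf_hyp i x); case: t.
Qed.

(** At most one label has weight below [eps] against it, because the two
    opposing weights add up to 1 and [eps < 1 / 2]. *)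
Lemma eps_majority_eq (R : realType) (X : Type) (eps : R)
    (H : weighted_family R X) x t :
  eps < 1 / 2 -> \sum_(i < wf_size H) wf_weight i = 1 ->
  weight_against H x t < eps -> eps_majority eps H x = t.
Proof.
move=> lt_eps sum1 lt_t; rewrite /eps_majority.
case: xgetP => [u _ /= lt_u|/(_ t)//].
have [//|neq_ut] := eqVneq u t.
have uE : u = ~~ t by case: u t neq_ut {lt_t lt_u} => [] [].
have := weight_againstC H x t; rewrite sum1 -uE; lra.
Qed.

Section Saturation.
Variables (R : realType) (X : Type) (eps : R) (HH : set (X -> bool)).

Lemma eps_saturation_step_mono m n : (m <= n)%N ->
  eps_saturation_step eps HH m `<=` eps_saturation_step eps HH n.
Proof.
move=> /subnK <-; elim: (n - m)%N => [|k IHk] // h /IHk.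
by rewrite addSn; left.
Qed.

(** The finitely many members of an [eps]-hypothesis all appear by some stage,
    so their majority appears at the next one. *)
Lemma eps_saturation_majority (H : weighted_family R X) :
  eps_hypothesis eps (eps_saturation eps HH) H ->
  eps_saturation eps HH (eps_majority eps H).
Proof.
case=> HHi inj w01 sum1 maj.
have /choice[stage stageP] : forall i : 'I_(wf_size H),
    exists n, eps_saturation_step eps HH n (wf_hyp i).
  by move=> i; have [n _ ?] := HHi i; exists n.
exists (\max_i stage i).+1 => //; right; exists H => //; split=> // i.
by apply: eps_saturation_step_mono (stageP i); exact: leq_bigmax.
Qed.

End Saturation.

(** * Half-graphs shatter trees *)

(** The label [c] gives both orientations of the half-graph at once.  The
    tree is a binary search: a query at the last point of the lower half
    separates the lower half of the functions from the upper half, and each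
    half is again a half-graph. *)
Lemma half_graph_shattered (X : Type) (HH : set (X -> bool))
    (a : nat -> X -> bool) (y : nat -> X) (c : bool) (d m : nat) :
  (forall l, (m <= l < m + 2 ^ d)%N -> HH (a l)) ->
  (forall l j, (m <= l < m + 2 ^ d)%N -> (m <= j < m + 2 ^ d)%N ->
    a l (y j) = (l <= j)%N (+) c) ->
  exists T : full_tree X d, shattered HH T.
Proof.
move=> HHa aE.
(* Remembering which functions realize each branch is what tells the answer
   at the root for the whole branch. *)
suff [T TP] : exists T : full_tree X d, forall b, branches T b ->
    exists2 l, (m <= l < m + 2 ^ d)%N & realizes (a l) b.
  by exists T => b /TP[l /HHa ? ?]; exists (a l).
elim: d m aE {HHa} => [|d IHd] m aE.
  by exists (Leaf X) => b ->; exists m => //; rewrite leqnn addn1 leqnn.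
have d_gt0 : (0 < 2 ^ d)%N by rewrite expn_gt0.
have dE : (2 ^ d.+1 = 2 ^ d + 2 ^ d)%N by rewrite expnS mul2n addnn.
rewrite dE in aE *.
have lowP l : (m <= l < m + 2 ^ d)%N -> (m <= l < m + (2 ^ d + 2 ^ d))%N.
  by case/andP=> -> /leq_trans-> //; rewrite leq_add2l leq_addr.
have highP l : (m + 2 ^ d <= l < m + 2 ^ d + 2 ^ d)%N ->
    (m <= l < m + (2 ^ d + 2 ^ d))%N.
  by rewrite -addnA => /andP[/(leq_trans (leq_addr _ _))-> ->].
have [|T1 T1P] := IHd m; first by move=> l j /lowP ? /lowP ?; exact: aE.
have [|T2 T2P] := IHd (m + 2 ^ d)%N.
  by move=> l j /highP ? /highP ?; exact: aE.
pose p := (m + 2 ^ d).-1.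
have pS : p.+1 = (m + 2 ^ d)%N by rewrite prednK // addn_gt0 d_gt0 orbT.
have pP : (m <= p < m + (2 ^ d + 2 ^ d))%N.
  apply: lowP; rewrite pS leqnn andbT -ltnS pS.
  by rewrite -[X in (X < _)%N]addn0 ltn_add2l.
have low b : branches T1 b -> exists2 l, (m <= l < m + (2 ^ d + 2 ^ d))%N &
    realizes (a l) ((y p, ~~ c) :: b).
  case/T1P=> l lP lb; exists l; first exact: lowP.
  by rewrite /= lb aE ?pP ?(lowP _ lP) //
    -[(l <= p)%N]ltnS pS (andP lP).2 addTb eqxx.
have high b : branches T2 b -> exists2 l, (m <= l < m + (2 ^ d + 2 ^ d))%N &
    realizes (a l) ((y p, c) :: b).
  case/T2P=> l lP lb; exists l; first exact: highP.
  by rewrite /= lb aE ?pP ?(highP _ lP) //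
    [(l <= p)%N]leqNgt pS (andP lP).1 addFb eqxx.
(* A lower-half function answers [~~ c] at the root, so [c] decides on which
   side the subtree of the lower half hangs. *)
clear - low high; case: c low high => low high.
  by exists (Node (y p) T1 T2) => b [] [b' b'P <-]; [exact: low|exact: high].
by exists (Node (y p) T2 T1) => b [] [b' b'P <-]; [exact: high|exact: low].
Qed.

(** * Generic approximating sequences *)

Lemma finite_transversal (X : Type) (T : finType) (F : X -> T) :
  exists2 Y : set X, finite_set Y & forall x, exists2 y, Y y & F y = F x.
Proof.
pose S t := [set y | exists e : exists x, F x = t, y = projT1 (cid e)].
exists (\bigcup_(t in [set: T]) S t).
  apply: bigcup_finite; first exact: finite_finset.
  move=> t _; have [e|ne] := pselect (exists x, F x = t); last first.
    by apply: (@sub_finite_set _ _ set0) => // y [e _]; case: ne.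
  apply: (@sub_finite_set _ _ [set projT1 (cid e)]) => // y [e' ->] /=.
  (* The chosen point depends on the existence proof only up to proof
     irrelevance, so each fibre contributes at most one point. *)
  by rewrite (Prop_irrelevance e' e).
move=> x; have e : exists x', F x' = F x by exists x.
by exists (projT1 (cid e)); [exists (F x) => //; exists e|exact: projT2 (cid e)].
Qed.

Lemma finite_pattern_transversal (X : Type) (s : seq (X -> bool)) :
  exists2 Y : set X, finite_set Y &
    forall x, exists2 y, Y y & map (@^~ y) s = map (@^~ x) s.
Proof.
have [Y finY YP] :=
  finite_transversal (fun x => map_tuple (@^~ x) (in_tuple s)).
exists Y => // x; have [y Yy /(congr1 val)/= E] := YP x.
by exists y.
Qed.

Definition limit_of (X : Type) (HH : set (X -> bool)) (f : X -> bool) : Prop :=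
  forall Y : set X, finite_set Y ->
    exists2 h, HH h & forall x, Y x -> h x = f x.

(** The local form of a Morley sequence of the type [f]: the functions before
    [n] see [y] as they see [x], while those from [n] on have already been made
    to agree with [f] at [y]. *)
Definition generic_sequence (X : Type) (f : X -> bool) (g : nat -> X -> bool) :=
  forall x n, exists y,
    [/\ f y = f x, forall i, (i < n)%N -> g i y = g i x
      & forall i, (n <= i)%N -> g i y = f y].

(** The next function is chosen to agree with [f] on representatives of the
    patterns of [f] and the functions chosen so far.  Accumulating these
    representatives is what makes all later functions agree with [f] there,
    and not only the next one. *)
Lemma exists_generic_sequence (X : Type) (HH : set (X -> bool)) (f : X -> bool) :
  limit_of HH f -> exists2 g, (forall n, HH (g n)) & generic_sequence f g.
Proof.
move=> limf.
have /choice[rep repP] : forall s : seq (X -> bool), exists Y : set X,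
    finite_set Y /\
    forall x, exists2 y, Y y & map (@^~ y) (f :: s) = map (@^~ x) (f :: s).
  by move=> s; have [Y] := finite_pattern_transversal (f :: s); exists Y.
have /choice[approx approxP] : forall Y : set X, exists h : X -> bool,
    finite_set Y -> HH h /\ forall x, Y x -> h x = f x.
  move=> Y; have [/limf[h ? ?]|nfin] := pselect (finite_set Y).
    by exists h.
  by exists f => /nfin.
(* Histories list the latest function first, so the tails of [s] are the
   earlier histories and [reps s] collects the representatives of all of them. *)
pose reps := fix reps s := if s is _ :: s' then rep s `|` reps s' else rep s.
pose hist := fix hist n :=
  if n is m.+1 then approx (reps (hist m)) :: hist m else [::].
pose g n := approx (reps (hist n)).
have fin_reps s : finite_set (reps s).
  elim: s => [|h s IHs] /=; first by have [] := repP [::].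
  by rewrite finite_setU; split=> //; have [] := repP (h :: s).
have repS s : rep s `<=` reps s by case: s => // h s; left.
have repsS n k : reps (hist n) `<=` reps (hist (k + n)%N).
  by elim: k => [//|k IHk] x /IHk; right.
have histE n i x y : map (@^~ y) (hist n) = map (@^~ x) (hist n) ->
    (i < n)%N -> g i y = g i x.
  elim: n => [//|n IHn] /= [gE sE]; rewrite ltnS leq_eqVlt.
  by case/predU1P=> [->|/IHn->].
exists g => [n|x n]; first by have [] := approxP _ (fin_reps (hist n)).
have [_ /(_ x)[y Yy [fE sE]]] := repP (hist n).
exists y; split=> // [i|i le_ni]; first exact: histE.
have [_ approxE] := approxP _ (fin_reps (hist i)); apply: approxE.
by rewrite -(subnK le_ni); apply: repsS; exact: repS.
Qed.

Section GenericSequence.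
Variables (X : Type) (HH : set (X -> bool)) (f : X -> bool).
Variable g : nat -> X -> bool.
Hypotheses (HHg : forall n, HH (g n)) (gen_g : generic_sequence f g).

(** Each [g i] errs at some [x]; the representative of the pattern of [x] at
    level [i.+1] is a point where [g i] still errs and every later function is
    right. *)
Lemma generic_sequence_inj : ~ HH f -> injective g.
Proof.
move=> nHf.
have neq i j : (i < j)%N -> g i <> g j.
  move=> lt_ij eq_ij; have /existsNP[x neq_x] : ~ forall x, g i x = f x.
    by move=> /funext gf; apply: nHf; rewrite -gf; exact: HHg.
  have [y [fy /(_ i (ltnSn i)) gy /(_ j lt_ij)]] := gen_g x i.+1.
  by rewrite -eq_ij gy fy.
by move=> i j eq_ij; case: (ltngtP i j) => // /neq; rewrite eq_ij.
Qed.

(** The point [y j] represents the pattern of [x] just after the [j]-th error: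
    errors up to the [j]-th are copied from [x], and later functions are
    right. *)
Lemma generic_sequence_half_graph x n
    (w := [seq i <- iota 0 n | g i x != f x]) :
  exists y : nat -> X, forall l j, (l < size w)%N -> (j < size w)%N ->
    g (nth 0 w l) (y j) = (l <= j)%N (+) f x.
Proof.
have w_sorted : sorted ltn w.
  by apply: sorted_filter; [exact: ltn_trans|exact: iota_ltn_sorted].
have /choice[y yP] j := gen_g x (nth 0 w j).+1.
exists y => l j lw jw; have [fy before after] := yP j.
case: leqP => [le_lj|lt_jl] /=.
  have : nth 0 w l \in w by exact: mem_nth.
  rewrite mem_filter => /andP[neq _].
  rewrite before; first by case: (g _ x) (f x) neq => [] [].
  by rewrite ltnS (sorted_leq_nth leq_trans leqnn) // (sub_sorted ltnW).
by rewrite after ?fy // (sorted_ltn_nth ltn_trans).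
Qed.

Lemma generic_sequence_count N x n :
  (forall d (T : full_tree X d), shattered HH T -> (d <= N)%N) ->
  (count (fun i => g i x != f x) (iota 0 n) < 2 ^ N.+1)%N.
Proof.
move=> HN; rewrite ltnNge -size_filter; apply/negP => le_size.
have [y yP] := generic_sequence_half_graph x n.
set w := [seq i <- _ | _] in le_size yP.
have [|l j|T /HN] :=
  @half_graph_shattered X HH (fun l => g (nth 0 w l)) y (f x) N.+1 0.
- by move=> l _; exact: HHg.
- by rewrite !add0n => /= lw jw; apply: yP; exact: leq_trans le_size.
- by rewrite ltnn.
Qed.

End GenericSequence.

(** * Types as pointwise limits *)

Lemma eps_type_limit (R : realType) (X : Type) (HH : set (X -> bool)) (eps : R) f :
  eps_type eps (eps_saturation eps HH) f -> limit_of (eps_saturation eps HH) f.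
Proof.
move=> tf Y /tf[H hypH HE]; exists (eps_majority eps H) => //.
exact: eps_saturation_majority.
Qed.

Theorem theorem6p2 (R : realType) (X : Type) (HH : set (X -> bool)) (eps : R)
    (heps : 0 < eps < 1 / 2)
    (HL : Littlestone (eps_saturation eps HH)) :
  eps_saturated eps (eps_saturation eps HH).
Proof.
move=> f /eps_type_limit limf; case/andP: heps => eps_gt0 eps_lt.
(* Assuming that [f] is not in the saturation makes the members of the
   hypothesis below distinct. *)
apply: contrapT => nGf.
have [g Gg gen_g] := exists_generic_sequence limf.
have inj_g := generic_sequence_inj Gg gen_g nGf.
have [N HN] := HL.
pose n := (Num.truncn ((2 ^ N.+1)%:R / eps)).+1.
have n_large : (2 ^ N.+1)%:R < n%:R * eps.
  by rewrite -ltr_pdivrMr // truncnS_gt.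
have n_gt0 : 0 < n%:R :> R by rewrite ltr0n.
pose H := @WeightedFamily R X n (fun i => g i) (fun=> n%:R^-1).
have against x : weight_against H x (f x) < eps.
  rewrite /weight_against /=.
  rewrite -(big_mkord (fun i => g i x == ~~ f x) (fun=> n%:R^-1)).
  rewrite big_const_seq iter_addr_0 /index_iota subn0 -[n%:R^-1 *+ _]mulr_natl.
  rewrite ltr_pdivrMr // mulrC; apply: le_lt_trans n_large.
  rewrite ler_nat ltnW //.
  rewrite (@eq_count _ _ (fun i => g i x != f x)).
    exact: (generic_sequence_count Gg gen_g).
  by move=> i /=; case: (g i x); case: (f x).
have sum1 : \sum_(i < wf_size H) wf_weight i = 1 :> R.
  by rewrite /= sumr_const card_ord -[LHS]mulr_natl divff // gt_eqF.
have hypH : eps_hypothesis eps (eps_saturation eps HH) H.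
  split=> //=.
  - by move=> i j /inj_g; exact: val_inj.
  - by move=> _; rewrite invr_gt0 n_gt0 invf_le1 // ler1n.
  - by move=> x; exists (f x).
apply: nGf; suff -> : f = eps_majority eps H by exact: eps_saturation_majority.
by apply/funext => x; rewrite (eps_majority_eq eps_lt sum1 (against x)).
Qed.
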